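(* Let $H$ be a Hilbert space and let $T\in L(H)$. Then the following statements hold. (i) $\sigma_{desc}(T)=\sigma_{desc}(L_T)$. (ii) $\sigma_{\mathcal{RD}}(T)=\sigma_{\mathcal{RD}}(L_T)$. (iii) $\sigma_{\mathcal{LD}}(T)=\sigma_{\mathcal{LD}}(L_T)$. (iv) $\sigma_{\mathcal{LD}}(T)=\sigma_{\mathcal{RD}}(R_T)$. (v) $\sigma_{\mathcal{RD}}(T)=\sigma_{\mathcal{LD}}(R_T)$. As a result, (vi) $\sigma_{\mathcal{DR}}(T)=\sigma_{\mathcal{LD}}(L_T)\cup\sigma_{\mathcal{LD}}(R_T)$.
   Context: Hilbert and Banach spaces are complex. For a Banach space $Y$, $L(Y)$ is the Banach algebra of all bounded linear operators on $Y$; $N(S)$ and $R(S)$ are the null space and range of $S\in L(Y)$. For $T\in L(H)$, the operators $L_T,R_T\in L(L(H))$ are the left and right multiplication operators $L_T(U)=TU$ and $R_T(U)=UT$ for $U\in L(H)$. For a Banach space $Y$ and $S\in L(Y)$, the descent is $d(S)=\inf\{n\ge 0: R(S^n)=R(S^{n+1})\}$ and the ascent is $a(S)=\inf\{n\ge 0: N(S^n)=N(S^{n+1})\}$, with $\inf\emptyset=\infty$. The operator $S$ is left Drazin invertible if $a(S)$ is finite and $R(S^{a(S)+1})$ is closed, and right Drazin invertible if $d(S)$ is finite and $R(S^{d(S)})$ is closed. Define $\sigma_{desc}(S)=\{\lambda\in\mathbb{C}: d(S-\lambda)=\infty\}$, $\sigma_{\mathcal{LD}}(S)=\{\lambda\in\mathbb{C}: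 S-\lambda\text{ is not left Drazin invertible}\}$, $\sigma_{\mathcal{RD}}(S)=\{\lambda\in\mathbb{C}: S-\lambda\text{ is not right Drazin invertible}\}$. An element $a$ of a unital Banach algebra $B$ with unit $e$ is Drazin invertible if there exist $b\in B$ and a non-negative integer $m$ such that $a^mba=a^m$, $bab=b$, $ab=ba$ (with $a^0=e$); its Drazin spectrum is $\sigma_{\mathcal{DR}}(a)=\{\lambda\in\mathbb{C}: a-\lambda e\text{ is not Drazin invertible}\}$. For $T\in L(H)$ this is taken in $B=L(H)$. *)

(* Defs.v *)
(* MathComp-Analysis; the complex field is R[i] for an arbitrary R : realType. *)
From HB Require Import structures.
From mathcomp Require Import all_boot all_order all_algebra.
From mathcomp Require Import complex sesquilinear.
From mathcomp Require Import all_classical all_reals.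
From mathcomp Require Import topology normedtype.

Set Implicit Arguments.
Unset Strict Implicit.
Unset Printing Implicit Defensive.

Import Order.TTheory GRing.Theory Num.Theory.

Local Open Scope classical_set_scope.
Local Open Scope ring_scope.

(* The inner product is linear in its first argument and conjugate-linear in
   the second; `|x| is the norm of the underlying Banach space. *)
HB.mixin Record hasInnerProduct (R : realType) H
    & CompleteNormedModule R[i] H := {
  inner : {dot H for (@Num.conj R[i])};
  sqr_normE : forall x : H, `|x| ^+ 2 = inner x x
}.

#[short(type="hilbertType")]
HB.structure Definition Hilbert (R : realType) :=
  {H of CompleteNormedModule R[i] H & hasInnerProduct R H}.

Record bounded_op (R : realType) (Y : normedModType R[i]) := BoundedOp {
  bop_fun :> Y -> Y;
  bop_linear : linear bop_fun;
  bop_bounded : exists M : R[i], forall x, `|bop_fun x| <= M * `|x|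
}.

Section BoundedOpTheory.
Variables (R : realType) (Y : normedModType R[i]).
Implicit Types (f g h : bounded_op Y) (x y : Y) (k : R[i]).

HB.instance Definition _ f :=
  GRing.isLinear.Build R[i] Y Y _ (bop_fun f) (bop_linear f).

HB.instance Definition _ := gen_eqMixin (bounded_op Y).
HB.instance Definition _ := gen_choiceMixin (bounded_op Y).

Lemma bop_ext f g : f =1 g -> f = g.
Proof.
case: f => f lf bf; case: g => g lg bg /= fg.
have {}fg : f = g by apply/funext.
by move: lf bf; rewrite fg => lf bf; congr BoundedOp; apply: Prop_irrelevance.
Qed.

Lemma bop_boundP f : exists2 M : R[i], 0 <= M & forall x, `|f x| <= M * `|x|.
Proof.
have [M fM] := bop_bounded f; exists `|M| => // x.
have M0 : 0 <= M * `|x| by rewrite (le_trans _ (fM x)).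
by rewrite (le_trans (fM x))// -(ger0_norm M0) normrM normr_id.
Qed.

Fact bop0_linear : linear (fun _ : Y => 0 : Y).
Proof. by move=> k x y; rewrite scaler0 addr0. Qed.
Fact bop0_bounded : exists M : R[i], forall x : Y, `|0 : Y| <= M * `|x|.
Proof. by exists 0 => x; rewrite normr0 mul0r. Qed.
Definition bop0 := BoundedOp bop0_linear bop0_bounded.

Fact bop_opp_linear f : linear (fun x => - f x).
Proof. by move=> k x y; rewrite linearP opprD scalerN. Qed.
Fact bop_opp_bounded f :
  exists M : R[i], forall x : Y, `|- f x| <= M * `|x|.
Proof.
by have [M _ fM] := bop_boundP f; exists M => x; rewrite normrN.
Qed.
Definition bop_opp f := BoundedOp (bop_opp_linear f) (bop_opp_bounded f).

Fact bop_add_linear f g : linear (fun x => f x + g x).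
Proof. by move=> k x y; rewrite !linearP scalerDr addrACA. Qed.
Fact bop_add_bounded f g :
  exists M : R[i], forall x : Y, `|f x + g x| <= M * `|x|.
Proof.
have [M _ fM] := bop_boundP f; have [N _ gN] := bop_boundP g.
by exists (M + N) => x; rewrite mulrDl (le_trans (ler_normD _ _))// lerD.
Qed.
Definition bop_add f g := BoundedOp (bop_add_linear f g) (bop_add_bounded f g).

Fact bop_scale_linear k f : linear (fun x => k *: f x).
Proof.
by move=> l x y; rewrite linearP scalerDr !scalerA (mulrC l k).
Qed.
Fact bop_scale_bounded k f :
  exists M : R[i], forall x : Y, `|k *: f x| <= M * `|x|.
Proof.
have [M _ fM] := bop_boundP f.
by exists (`|k| * M) => x; rewrite normrZ -mulrA ler_wpM2l.
Qed.
Definition bop_scale k f :=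
  BoundedOp (bop_scale_linear k f) (bop_scale_bounded k f).

Fact bop1_linear : linear (fun x : Y => x).
Proof. by []. Qed.
Fact bop1_bounded : exists M : R[i], forall x : Y, `|x| <= M * `|x|.
Proof. by exists 1 => x; rewrite mul1r. Qed.
Definition bop1 := BoundedOp bop1_linear bop1_bounded.

Fact bop_mul_linear f g : linear (fun x => f (g x)).
Proof. by move=> k x y; rewrite !linearP. Qed.
Fact bop_mul_bounded f g :
  exists M : R[i], forall x : Y, `|f (g x)| <= M * `|x|.
Proof.
have [M M0 fM] := bop_boundP f; have [N _ gN] := bop_boundP g.
by exists (M * N) => x; rewrite (le_trans (fM _))// -mulrA ler_wpM2l.
Qed.
Definition bop_mul f g := BoundedOp (bop_mul_linear f g) (bop_mul_bounded f g).

Fact bop_addA : associative bop_add.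
Proof. by move=> f g h; apply: bop_ext => x /=; rewrite addrA. Qed.
Fact bop_addC : commutative bop_add.
Proof. by move=> f g; apply: bop_ext => x /=; rewrite addrC. Qed.
Fact bop_add0 : left_id bop0 bop_add.
Proof. by move=> f; apply: bop_ext => x /=; rewrite add0r. Qed.
Fact bop_addN : left_inverse bop0 bop_opp bop_add.
Proof. by move=> f; apply: bop_ext => x /=; rewrite addNr. Qed.

HB.instance Definition _ := GRing.isZmodule.Build (bounded_op Y)
  bop_addA bop_addC bop_add0 bop_addN.

Fact bop_mulA : associative bop_mul.
Proof. by move=> f g h; apply: bop_ext. Qed.
Fact bop_mul1 : left_id bop1 bop_mul.
Proof. by move=> f; apply: bop_ext. Qed.
Fact bop_1mul : right_id bop1 bop_mul.
Proof. by move=> f; apply: bop_ext. Qed.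
Fact bop_mulDl : left_distributive bop_mul +%R.
Proof. by move=> f g h; apply: bop_ext. Qed.
Fact bop_mulDr : right_distributive bop_mul +%R.
Proof. by move=> f g h; apply: bop_ext => x /=; rewrite linearD. Qed.

HB.instance Definition _ := GRing.Zmodule_isPzRing.Build (bounded_op Y)
  bop_mulA bop_mul1 bop_1mul bop_mulDl bop_mulDr.

Fact bop_scaleA k l f :
  bop_scale k (bop_scale l f) = bop_scale (k * l) f.
Proof. by apply: bop_ext => x /=; rewrite scalerA. Qed.
Fact bop_scale1 : left_id 1 bop_scale.
Proof. by move=> f; apply: bop_ext => x /=; rewrite scale1r. Qed.
Fact bop_scaleDr : right_distributive bop_scale +%R.
Proof. by move=> k f g; apply: bop_ext => x /=; rewrite scalerDr. Qed.
Fact bop_scaleDl f : {morph bop_scale^~ f : k l / k + l}.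
Proof. by move=> k l; apply: bop_ext => x /=; rewrite scalerDl. Qed.

HB.instance Definition _ := GRing.Zmodule_isLmodule.Build R[i] (bounded_op Y)
  bop_scaleA bop_scale1 bop_scaleDr bop_scaleDl.

Lemma bopN f x : (- f) x = - f x. Proof. by []. Qed.
Lemma bopD f g x : (f + g) x = f x + g x. Proof. by []. Qed.
Lemma bopB f g x : (f - g) x = f x - g x. Proof. by []. Qed.
Lemma bopZ k f x : (k *: f) x = k *: f x. Proof. by []. Qed.
Lemma bopM f g x : (f * g) x = f (g x). Proof. by []. Qed.

(* Norms take their values in R[i], where order is partial; the supremum is
   therefore taken in R and then embedded. *)
Definition opnorm f : R[i] :=
  (sup [set complex.Re `|f x| | x in [set x : Y | `|x| <= 1]])%:C%C.


Let ReK (z : R[i]) : 0 <= z -> (complex.Re z)%:C%C = z.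
Proof. by move=> z0; rewrite RRe_real// ger0_real. Qed.

Let Re_le (z w : R[i]) : z <= w -> complex.Re z <= complex.Re w.
Proof. by rewrite lecE => /andP[]. Qed.

Let opnorm_has_sup f :
  has_sup [set complex.Re `|f x| | x in [set x : Y | `|x| <= 1]].
Proof.
split; first by exists (complex.Re `|f 0|), 0 => //=; rewrite normr0.
have [M M0 fM] := bop_boundP f; exists (complex.Re M) => _ [x /= x1 <-].
by apply: Re_le; rewrite (le_trans (fM x))// ler_piMr.
Qed.

Lemma opnorm_ge0 f : 0 <= opnorm f.
Proof.
rewrite ler0c; apply: (sup_upper_bound (opnorm_has_sup f)).
by exists 0 => /=; rewrite ?linear0 ?normr0.
Qed.

Lemma opnorm_le f x : `|f x| <= opnorm f * `|x|.
Proof.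
have [->|x0] := eqVneq x 0; first by rewrite linear0 normr0 mulr0.
have nx : 0 < `|x| by rewrite normr_gt0.
rewrite -ler_pdivrMr// mulrC.
have -> : `|x|^-1 * `|f x| = `|f (`|x|^-1 *: x)|.
  by rewrite linearZ normrZ ger0_norm// invr_ge0 ltW.
rewrite -[leLHS]ReK// lecR; apply: (sup_upper_bound (opnorm_has_sup f)).
by exists (`|x|^-1 *: x) => //=; rewrite normfZV.
Qed.

Lemma opnorm_ub f (M : R[i]) :
  0 <= M -> (forall x, `|f x| <= M * `|x|) -> opnorm f <= M.
Proof.
move=> M0 fM; rewrite -[M]ReK// lecR; apply: ge_sup.
  by case: (opnorm_has_sup f).
by move=> _ [x /= x1 <-]; apply: Re_le; rewrite (le_trans (fM x))// ler_piMr.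
Qed.

Fact opnormD f g : opnorm (f + g) <= opnorm f + opnorm g.
Proof.
apply: opnorm_ub => [|x]; first by rewrite addr_ge0 ?opnorm_ge0.
by rewrite bopD (le_trans (ler_normD _ _))// mulrDl lerD ?opnorm_le.
Qed.

Fact opnormZ k f : opnorm (k *: f) = `|k| * opnorm f.
Proof.
have le l h : opnorm (l *: h) <= `|l| * opnorm h.
  apply: opnorm_ub => [|x]; first by rewrite mulr_ge0 ?opnorm_ge0.
  by rewrite bopZ normrZ -mulrA ler_wpM2l ?opnorm_le.
apply/le_anti; rewrite le/=.
have [->|k0] := eqVneq k 0; first by rewrite normr0 mul0r opnorm_ge0.
rewrite -ler_pdivlMl ?normr_gt0// -normfV.
by rewrite -[f in leLHS]scale1r -(mulVf k0) -scalerA le.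
Qed.

Fact opnorm_eq0 f : opnorm f = 0 -> f = 0.
Proof.
move=> f0; apply: bop_ext => x; apply/eqP; rewrite -normr_le0.
by have := opnorm_le f x; rewrite f0 mul0r.
Qed.

HB.instance Definition _ := @Lmodule_isNormed.Build R[i] (bounded_op Y)
  (@opnorm) opnormD opnormZ opnorm_eq0.

Lemma bop_normE f : `|f| = opnorm f. Proof. by []. Qed.

Lemma bop_norm_le f x : `|f x| <= `|f| * `|x|.
Proof. exact: opnorm_le. Qed.

Lemma bop_normM f g : `|f * g| <= `|f| * `|g|.
Proof.
apply: opnorm_ub => [|x]; first by rewrite mulr_ge0.
by rewrite bopM (le_trans (bop_norm_le _ _))// -mulrA ler_wpM2l ?bop_norm_le.
Qed.

End BoundedOpTheory.

Section BoundedOpComplete.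
Variables (R : realType) (Y : completeNormedModType R[i]).

Let cauchy_eval (F : set_system (bounded_op Y)) x :
  ProperFilter F -> cauchy F -> cvg ((fun f : bounded_op Y => f x) @ F).
Proof.
move=> FF /cauchy_ballP Fc; apply: cauchy_cvg; apply/cauchy_ballP => e e0.
have nx : 0 < `|x| + 1 :> R[i] by rewrite ltr_wpDl.
have d0 : 0 < e / (`|x| + 1) by rewrite divr_gt0.
have [[A B] /= [FA FB] AB] := Fc _ d0.
exists ((fun f : bounded_op Y => f x) @` A, (fun f : bounded_op Y => f x) @` B).
  by split; [apply: filterS FA => f Af|apply: filterS FB => f Bf]; exists f.
move=> [_ _] /= [[f Af <-] [g Bg <-]].
have := AB (f, g) (conj Af Bg); rewrite -!ball_normE /= => fg.
rewrite -bopB (le_lt_trans (bop_norm_le _ _))//.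
rewrite (@le_lt_trans _ _ (`|f - g| * (`|x| + 1)))//.
  by rewrite ler_wpM2l// lerDl.
by rewrite -ltr_pdivlMr.
Qed.

Let lim_le (F : set_system (bounded_op Y)) (FF : ProperFilter F) x y z
    (M : R[i]) : (fun f : bounded_op Y => f x) @ F --> y ->
  (\forall f \near F, `|(f : bounded_op Y) x - z| <= M) -> `|y - z| <= M.
Proof.
move=> /cvgrPdist_le yF zF; apply/ler_addgt0Pr => e e0; near F => f.
rewrite -(subrKA (f x)) addrC (le_trans (ler_normD _ _))// lerD//.
  by near: f.
by near: f; apply: yF.
Unshelve. all: end_near. Qed.

Lemma bop_complete (F : set_system (bounded_op Y)) :
  ProperFilter F -> cauchy F -> cvg F.
Proof.
move=> FF Fc; pose l x := lim ((fun f : bounded_op Y => f x) @ F).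
have lF x : (fun f : bounded_op Y => f x) @ F --> l x by apply: cauchy_eval.
have llin : linear l.
  move=> k x y; apply: norm_cvg_unique (lF _) _.
  rewrite (_ : (fun f : bounded_op Y => _) =
    (fun f : bounded_op Y => k *: f x + f y)); last first.
    by apply/funext => f; rewrite linearP.
  by apply: cvgD => //; apply: cvgZl_tmp.
have fg (e : R[i]) : 0 < e ->
    \forall f \near F & g \near F, `|(f : bounded_op Y) - g| <= e.
  move=> e0; have /cauchy_ballP/(_ _ e0) := Fc.
  by apply: filterS => -[f g] /=; rewrite -ball_normE => /ltW.
have lM (e : R[i]) : 0 < e -> \forall g \near F, forall x, `|l x - (g : bounded_op Y) x| <= e * `|x|.
  move=> e0; near=> g => x; apply: (@lim_le F FF x _ _ _ (lF x)).
  have : \forall f \near F, `|g - (f : bounded_op Y)| <= e by near: g; apply: nearP_dep; apply: fg.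
  apply: filterS => f gf; rewrite distrC -bopB.
  by rewrite (le_trans (bop_norm_le _ _))// ler_wpM2r.
have lb : exists M : R[i], forall x, `|l x| <= M * `|x|.
  near F => g; exists (1 + `|g|) => x.
  rewrite -[l x](subrK (g x)) mulrDl (le_trans (ler_normD _ _))// lerD//.
    by move: x; near: g; apply: lM.
  exact: bop_norm_le.
apply/cvg_ex; exists (BoundedOp llin lb).
apply/(@cvgrPdist_le _ _ _ F) => e e0; near=> g.
apply: opnorm_ub; first exact: ltW.
by near: g; exact: lM.
Unshelve. all: end_near. Qed.

HB.instance Definition _ :=
  Uniform_isComplete.Build (bounded_op Y) bop_complete.

End BoundedOpComplete.

(* The infimum of a set of naturals in the extended naturals: None stands for
   the infinite value, taken exactly on the empty set. *)
Definition inf_nat (A : set nat) : option nat :=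
  match pselect (exists n, `[< A n >]) with
  | left exA => Some (ex_minn exA)
  | right _ => None
  end.

Section Spectra.
Variables (R : realType) (Y : completeNormedModType R[i]).
Implicit Types (S : bounded_op Y).

(* Powers are taken in the ring bounded_op Y, whose product is composition. *)
Definition null_space S : set Y := [set x | S x = 0].

Definition ascent S : option nat :=
  inf_nat [set n | null_space (S ^+ n) = null_space (S ^+ n.+1)].

Definition descent S : option nat :=
  inf_nat [set n | range (S ^+ n) = range (S ^+ n.+1)].

Definition left_drazin_invertible S : Prop :=
  exists2 n, ascent S = Some n & closed (range (S ^+ n.+1)).

Definition right_drazin_invertible S : Prop :=
  exists2 n, descent S = Some n & closed (range (S ^+ n)).

Definition sigma_desc S : set R[i] :=
  [set l | descent (S - l *: (1 : bounded_op Y)) = None].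

Definition sigma_LD S : set R[i] :=
  [set l | ~ left_drazin_invertible (S - l *: (1 : bounded_op Y))].

Definition sigma_RD S : set R[i] :=
  [set l | ~ right_drazin_invertible (S - l *: (1 : bounded_op Y))].

End Spectra.

(* Only the ring structure of the Banach algebra enters the definition; a
   possibly trivial ring is allowed so as to cover the zero space. *)
Definition drazin_invertible (B : pzRingType) (a : B) : Prop :=
  exists (b : B) (m : nat),
    [/\ a ^+ m * b * a = a ^+ m, b * a * b = b & a * b = b * a].

Definition sigma_DR (R : realType) (Y : completeNormedModType R[i])
    (S : bounded_op Y) : set R[i] :=
  [set l | ~ drazin_invertible (S - l *: (1 : bounded_op Y))].

Section Multiplication.
Variables (R : realType) (Y : completeNormedModType R[i]).
Implicit Types (T U : bounded_op Y).

Fact left_mul_linear T : linear (fun U => T * U).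
Proof. by move=> k U V; apply: bop_ext => x /=; rewrite linearP. Qed.
Fact left_mul_bounded T :
  exists M : R[i], forall U, `|T * U| <= M * `|U|.
Proof. by exists `|T| => U; apply: bop_normM. Qed.
Definition left_mul T : bounded_op (bounded_op Y) :=
  BoundedOp (left_mul_linear T) (left_mul_bounded T).

Fact right_mul_linear T : linear (fun U => U * T).
Proof. by move=> k U V; apply: bop_ext. Qed.
Fact right_mul_bounded T :
  exists M : R[i], forall U, `|U * T| <= M * `|U|.
Proof. by exists `|T| => U; rewrite mulrC; apply: bop_normM. Qed.
Definition right_mul T : bounded_op (bounded_op Y) :=
  BoundedOp (right_mul_linear T) (right_mul_bounded T).

End Multiplication.

(* Main.v *)
Require Import Defs.
From mathcomp Require Import all_boot all_order all_algebra.
From mathcomp Require Import complex sesquilinear.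
From mathcomp Require Import all_classical all_reals.
From mathcomp Require Import topology normedtype.
From mathcomp Require Import ring lra.

Set Implicit Arguments.
Unset Strict Implicit.
Unset Printing Implicit Defensive.

Import Order.TTheory GRing.Theory Num.Theory.

Local Open Scope classical_set_scope.
Local Open Scope ring_scope.

(** Everything is read off from ring-theoretic properties of T - l, written A
    below, in the ring L(H). Left and right multiplication by S are written
    L_S and R_S.

    Call A left stable at n if A^n lies in L(H) A^(n+1), right stable at n if
    A^n lies in A^(n+1) L(H), and call S regular if S E S = S for some E. The
    heart of the proof is that A is left (right) Drazin invertible exactly
    when, for some n, A is left (right) stable at n and A^n is regular
    ([left_drazinP], [right_drazinP]). The adjoint exchanges the two sides, so
    A is left Drazin invertible iff its adjoint is right Drazin invertible.
    Moreover A is Drazin invertible iff it is both left and right Drazin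
    invertible: left and right stability produce a Drazin inverse
    ([stable_drazin_invertible]), and conversely a Drazin inverse yields both
    stability properties and a generalized inverse of a power
    ([drazin_invertible_stable]).

    Two facts about Hilbert space translate geometry into algebra. The first
    is Douglas' lemma ([douglas]): if the range of V is included in the range
    of S, then V = S C for a bounded C. Hence equality of the ranges of A^n and
    A^(n+1) is right stability. It follows that the range of S is closed iff S
    is regular ([closed_range_regular]), by factoring through S the orthogonal
    projection onto its range. The second is that rank-one operators embed H
    in L(H), so that null spaces and closed ranges of left multiplications
    determine those of the operators themselves.

    For left multiplication, Douglas' lemma says that the range of L_S is the
    set of the operators whose range is included in the range of S; so L_A and
    A have the same descent, the same ascent, and powers with closed ranges at
    the same exponents. For right multiplication, the adjoint is a continuous
    involution of L(H) that exchanges R_A with left multiplication by the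
    adjoint of A, so that everything reduces to the previous case.

    Douglas' lemma rests on the uniform boundedness principle, in the form that
    a weakly bounded subset of H is bounded ([weakly_bounded_bounded]). *)

(** * Real-valued norms, closed sets and completeness *)

Section RealNorm.
Variables (R : realType) (Y : normedModType R[i]).
Implicit Types (x y z : Y) (A : set Y).

(** The norm takes its values in R[i], whose order is only partial; infima and
    estimates are taken on its real value instead. *)
Definition rnorm x : R := complex.Re `|x|.

Lemma rnormE x : `|x| = (rnorm x)%:C%C.
Proof. by rewrite RRe_real// ger0_real. Qed.

Lemma rnorm_ge0 x : 0 <= rnorm x.
Proof. by rewrite -ler0c -rnormE. Qed.

Lemma rnormD x y : rnorm (x + y) <= rnorm x + rnorm y.
Proof. by rewrite -lecR rmorphD/= -!rnormE ler_normD. Qed.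

Lemma rnormC x y : rnorm (x - y) = rnorm (y - x).
Proof. by rewrite /rnorm distrC. Qed.

Lemma rnorm_triangle y x z : rnorm (x - z) <= rnorm (x - y) + rnorm (y - z).
Proof. by rewrite -[x - z](subrKA y) rnormD. Qed.

Lemma rnorm0 : rnorm (0 : Y) = 0.
Proof. by rewrite /rnorm normr0. Qed.

Lemma rnorm0_eq0 x : rnorm x = 0 -> x = 0.
Proof. by move=> x0; apply/eqP; rewrite -normr_eq0 rnormE x0. Qed.

Lemma rnormZr (k : R) x : rnorm (k%:C%C *: x) = `|k| * rnorm x.
Proof.
apply: complexI; rewrite rmorphM/= -!rnormE normrZ; congr (_ * _).
by rewrite normc_def/= expr0n addr0 sqrtr_sqr.
Qed.

Lemma ballC_rnorm x (e : R) y : ball x e%:C%C y <-> rnorm (x - y) < e.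
Proof. by rewrite -ball_normE /= rnormE ltcR. Qed.

Lemma gt0C (e : R[i]) : 0 < e -> exists2 d : R, 0 < d & e = d%:C%C.
Proof.
move=> e0; exists (complex.Re e); last by rewrite RRe_real// gtr0_real.
by rewrite -ltcR RRe_real// gtr0_real.
Qed.

Lemma closure_rnormP A x : closure A x <->
  forall e : R, 0 < e -> exists2 a, A a & rnorm (x - a) < e.
Proof.
split=> [Ax e e0|xA B /nbhs_ballP[_ /gt0C[d d0 ->] xB]].
  have [] := Ax (ball x e%:C%C); first by apply: nbhsx_ballx; rewrite ltcR.
  by move=> a [Aa /ballC_rnorm xa]; exists a.
by have [a Aa xa] := xA _ d0; exists a; split=> //; apply/xB/ballC_rnorm.
Qed.

Lemma closed_rnormP A : closed A <->
  forall x, (forall e : R, 0 < e -> exists2 a, A a & rnorm (x - a) < e) -> A x.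
Proof. by split=> cA x /closure_rnormP/cA. Qed.

Lemma closure_linear A :
  (forall (k : R[i]) x y, A x -> A y -> A (k *: x + y)) ->
  forall (k : R[i]) x y, closure A x -> closure A y -> closure A (k *: x + y).
Proof.
move=> A_linear k x y /closure_rnormP xA /closure_rnormP yA.
apply/closure_rnormP => e e0; pose c := complex.Re `|k|.
have kc : `|k| = c%:C%C by rewrite RRe_real ?normr_real.
have c0 : 0 <= c by rewrite -ler0c -kc.
have e2 : 0 < e / 2 by rewrite divr_gt0.
have [a Aa xa] := xA (e / 2 / (c + 1)) (divr_gt0 e2 (ltr_wpDl c0 ltr01)).
have [b Ab yb] := yA _ e2.
exists (k *: a + b); first exact: A_linear.
rewrite opprD addrACA -scalerBr (le_lt_trans (rnormD _ _))//.
have -> : rnorm (k *: (x - a)) = c * rnorm (x - a).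
  by apply: complexI; rewrite rmorphM/= -!rnormE normrZ kc.
move: xa; rewrite ltr_pdivlMr ?ltr_wpDl//; have := rnorm_ge0 (x - a); nra.
Qed.

End RealNorm.

Lemma closed_kernel (R : realType) (Y Z : normedModType R[i]) (f : Y -> Z) :
  (forall x y, f (x - y) = f x - f y) ->
  (exists C : R[i], forall x, `|f x| <= C * `|x|) ->
  closed [set x | f x = 0].
Proof.
move=> fB [C fC]; apply/closed_rnormP => x xf; pose c := complex.Re `|C|.
have c0 : 0 <= c by rewrite -ler0c RRe_real ?normr_real.
have fc y : rnorm (f y) <= c * rnorm y.
  rewrite -lecR rmorphM/= -!rnormE RRe_real ?normr_real//.
  have C0 : 0 <= C * `|y| by rewrite (le_trans _ (fC y)).
  by rewrite (le_trans (fC y))// -(ger0_norm C0) normrM normr_id.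
apply: rnorm0_eq0; apply/eqP; rewrite eq_le rnorm_ge0 andbT.
apply/ler_addgt0Pr => e e0; rewrite add0r.
have [a fa xa] := xf _ (divr_gt0 e0 (ltr_wpDl c0 ltr01)).
rewrite -[f x]subr0 -(fa : f a = 0) -fB (le_trans (fc _))//.
have : (c + 1) * rnorm (x - a) <= e by rewrite mulrC -ler_pdivlMr ?ltr_wpDl// ltW.
by apply: le_trans; rewrite ler_wpM2r ?rnorm_ge0// lerDl.
Qed.

Section Completeness.
Variables (R : realType) (Y : completeNormedModType R[i]).

Lemma rnorm_complete (u : nat -> Y) :
  (forall e : R, 0 < e ->
     exists N, forall m n, (N <= m)%N -> (N <= n)%N -> rnorm (u m - u n) < e) ->
  exists l, forall e : R, 0 < e ->
     exists N, forall n, (N <= n)%N -> rnorm (l - u n) < e.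
Proof.
move=> uC.
have /cvg_ex[l ul] : cvg (u @ \oo).
  apply: cauchy_cvg; apply/cauchy_ballP => _ /gt0C[d d0 ->].
  have [N uN] := uC _ d0; pose B := u @` [set n | (N <= n)%N].
  have uB : (u @ \oo) B by exists N => // n Nn; exists n.
  exists (B, B) => //= -[_ _] /= [[m Nm <-] [n Nn <-]].
  by apply/ballC_rnorm; apply: uN.
exists l => e e0; have eC : 0 < e%:C%C :> R[i] by rewrite ltcR.
have [N _ uN] := (iffLR (cvgrPdist_lt _ _) ul) _ eC.
by exists N => n Nn; have := uN _ Nn; rewrite rnormE /= ltcR.
Qed.

End Completeness.

(** * Stability and regularity in a ring *)

Section StrongRegularity.
Variable B : pzRingType.
Implicit Types (a b c d e : B) (m n : nat).

Definition regular a := exists e, a * e * a = a.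
Definition left_stable a n := exists c, a ^+ n = c * a ^+ n.+1.
Definition right_stable a n := exists c, a ^+ n = a ^+ n.+1 * c.

Lemma left_stable_factor a m n : left_stable a m -> (m <= n)%N ->
  exists d, a ^+ m = d * a ^+ n.
Proof.
move=> [c am] /subnKC <-; elim: (n - m)%N => [|k [d amk]].
  by exists 1; rewrite addn0 mul1r.
by exists (c * d); rewrite addnS exprSr mulrA -(mulrA c) -amk -mulrA -exprSr.
Qed.

Lemma right_stable_factor a m n : right_stable a m -> (m <= n)%N ->
  exists d, a ^+ m = a ^+ n * d.
Proof.
move=> [c am] /subnKC <-; elim: (n - m)%N => [|k [d amk]].
  by exists 1; rewrite addn0 mulr1.
by exists (d * c); rewrite addnS exprS -mulrA (mulrA _ d) -amk mulrA -exprS.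
Qed.

(** With a^m = d a^n and a^n e a^n = a^n, the element e a^(n - m) is a
    generalized inverse of a^m; conversely e d is one of a^n as soon as
    a^m e a^m = a^m. *)
Lemma left_stable_regular a m n : left_stable a m -> (m <= n)%N ->
  regular (a ^+ n) <-> regular (a ^+ m).
Proof.
move=> am mn; have [d ad] := left_stable_factor am mn; split=> -[e ae].
  by exists (e * a ^+ (n - m)); rewrite -!mulrA -exprD subnK// mulrA ad -!mulrA
    (mulrA _ e) ae.
exists (e * d); rewrite -!mulrA -ad -{1}(subnK mn) exprD -!mulrA (mulrA _ e) ae.
by rewrite -exprD subnK.
Qed.

(** Taking p above both exponents, a^p = c a^(p+1) = a^(p+1) d, whence
    c^k a^p = a^p d^k for all k; the common value for k = p + 1 commutes with a
    and is the Drazin inverse. *)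
Lemma stable_drazin_invertible a m n :
  left_stable a m -> right_stable a n -> drazin_invertible a.
Proof.
pose p := maxn m n; move=> [c am] [d an].
have stepl k : (m <= k)%N -> a ^+ k = c * a ^+ k.+1.
  by move=> /subnKC <-; rewrite -addSn !exprD mulrA -am.
have stepr k : (n <= k)%N -> a ^+ k = a ^+ k.+1 * d.
  by move=> /subnK <-; rewrite -addnS !exprD -mulrA -an.
have apl : a ^+ p = c * a ^+ p.+1 by rewrite stepl ?leq_maxl.
have apr : a ^+ p = a ^+ p.+1 * d by rewrite stepr ?leq_maxr.
have swap : c * a ^+ p = a ^+ p * d by rewrite {1}apr mulrA -apl.
have swapX k : c ^+ k * a ^+ p = a ^+ p * d ^+ k.
  elim: k => [|k IH]; first by rewrite !expr0 mul1r mulr1.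
  by rewrite exprSr -mulrA swap mulrA IH -mulrA -exprSr.
have drop k : a ^+ p = a ^+ (k + p) * d ^+ k.
  elim: k => [|k IH]; first by rewrite mulr1.
  rewrite exprS mulrA addSn -addnS exprD -(mulrA (a ^+ k)) -apr -exprD.
  exact: IH.
pose b := a ^+ p * d ^+ p.+1.
have ab : a * b = a ^+ p * d ^+ p by rewrite mulrA -exprS (exprS d) mulrA -apr.
have ba : b * a = a ^+ p * d ^+ p.
  by rewrite /b -swapX -mulrA -exprSr (exprSr c) -mulrA -apl swapX.
exists b, p; split; last by rewrite ab ba.
  by rewrite -mulrA ba mulrA -exprD -drop.
by rewrite -mulrA ab /b -{1}swapX -!mulrA (mulrA (a ^+ p)) -exprD -drop swapX.
Qed.

(** If b is a Drazin inverse, then a^m = a^(m+k) b^k for all k; for k = m this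
    exhibits b^m as a generalized inverse of a^m. *)
Lemma drazin_invertible_stable a : drazin_invertible a -> exists m,
  [/\ left_stable a m, right_stable a m & regular (a ^+ m)].
Proof.
move=> [b [m [amba _ ab]]].
have cm : b * a ^+ m = a ^+ m * b by apply/commrX/commr_sym.
have am : a ^+ m.+1 * b = a ^+ m.
  by rewrite exprSr -mulrA ab mulrA.
exists m; split.
- by exists b; rewrite exprS mulrA -ab -mulrA cm mulrA -exprS am.
- by exists b.
exists (b ^+ m).
suff : forall k, a ^+ m = a ^+ (k + m) * b ^+ k.
  move=> /(_ m) {3}->; rewrite exprD -!mulrA; congr (_ * _).
  by apply: commrX; apply/commr_sym/commrX/commr_sym.
elim=> [|k IH]; first by rewrite mulr1.
by rewrite exprS mulrA addSn -addnS exprD -(mulrA (a ^+ k)) am -exprD.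
Qed.

End StrongRegularity.

(** * Orthogonal projections *)

Section Geometry.
Variables (R : realType) (H : hilbertType R).
Implicit Types (x y z : H) (k : R[i]).
Local Notation "''[' x , y ]" := (inner x y) : ring_scope.

Lemma innerC x y : '[x, y] = '[y, x]^*.
Proof. by rewrite hermC expr0 mul1r. Qed.

Lemma innerxx_eq0 x : '[x, x] = 0 -> x = 0.
Proof.
by rewrite -sqr_normE => /eqP; rewrite expf_eq0/= normr_eq0 => /eqP.
Qed.

Lemma inner_inj x y : (forall z, '[z, x] = '[z, y]) -> x = y.
Proof.
move=> xy; apply/eqP; rewrite -subr_eq0; apply/eqP; apply: innerxx_eq0.
by rewrite linearBr/= xy subrr.
Qed.

(** The vector subtracted from x is its projection onto the line of y. The
    Cauchy-Schwarz inequality says that the right-hand side is nonnegative;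
    and if x is not longer than x - k y for any k, then x is orthogonal to y. *)
Lemma sqr_norm_residual x y : y != 0 ->
  `|x - ('[x, y] / `|y| ^+ 2) *: y| ^+ 2 =
  `|x| ^+ 2 - `|'[x, y]| ^+ 2 / `|y| ^+ 2.
Proof.
move=> y0; have ny : `|y| ^+ 2 != 0 by rewrite expf_neq0// normr_eq0.
set k := _ / _; rewrite !sqr_normE dnormB dnormZ.
rewrite linearZr_LR/= !rmorphM/= conjCK.
have nyC : (`|y| ^- 2)^* = `|y| ^- 2.
  by rewrite conj_Creal// rpredV rpredX// normr_real.
rewrite !nyC normrM normfV normrX normr_id -!sqr_normE exprMn exprVn normCK.
move: (`|y| ^+ 2) ny => n n0; move: ('[x, y]) ('[x, y]^* ) (`|x| ^+ 2) => a b c.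
by field.
Qed.

Lemma CauchySchwarz_inner x y : `|'[x, y]| <= `|x| * `|y|.
Proof.
have [->|y0] := eqVneq y 0; first by rewrite linear0r !normr0 mulr0.
have ny : 0 < `|y| ^+ 2 by rewrite exprn_gt0// normr_gt0.
rewrite -(@ler_pXn2r _ 2)// ?nnegrE ?mulr_ge0// exprMn -ler_pdivrMr//.
by rewrite -subr_ge0 -sqr_norm_residual// exprn_ge0.
Qed.

Lemma parallelogram x y :
  rnorm (x + y) ^+ 2 + rnorm (x - y) ^+ 2 =
  2 * rnorm x ^+ 2 + 2 * rnorm y ^+ 2.
Proof.
apply: complexI; rewrite !(rmorphD, rmorphM, rmorph1)/= -!rnormE.
rewrite -!expr2 !sqr_normE dnormD dnormB.
move: ('[x, x]) ('[y, y]) ('[x, y]) ('[x, y]^* ) => a b c d; ring.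
Qed.

End Geometry.

Section Projection.
Variables (R : realType) (H : hilbertType R) (M : set H).
Hypotheses (M_linear : forall k x y, M x -> M y -> M (k *: x + y)).
Hypotheses (M0 : M 0) (M_closed : closed M).
Implicit Types (x y z : H) (k : R[i]).
Local Notation "''[' x , y ]" := (inner x y) : ring_scope.

Let MZ k x : M x -> M (k *: x).
Proof. by move=> Mx; rewrite -[_ *: _]addr0; apply: M_linear. Qed.

(** By the parallelogram identity, a minimizing sequence for the distance d
    from x to M is a Cauchy sequence: the midpoint of two of its terms belongs
    to M, hence is at distance at least d from x. *)
Lemma nearest_point x :
  exists2 y, M y & forall m, M m -> rnorm (x - y) <= rnorm (x - m).
Proof.
pose D := [set rnorm (x - m) | m in M]; pose d := inf D.
have D0 : has_inf D.
  by split; [exists (rnorm (x - 0)), 0|exists 0 => _ [m _ <-]; apply: rnorm_ge0].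
have dM m : M m -> d <= rnorm (x - m).
  by move=> Mm; apply: ge_inf; [case: D0|exists m].
have d0 : 0 <= d.
  by apply: lb_le_inf; [case: D0|move=> _ [m _ <-]; apply: rnorm_ge0].
have en n : 0 < n.+1%:R^-1 :> R by rewrite invr_gt0.
have /choice[u uP] (n : nat) : exists m, M m /\ rnorm (x - m) < d + n.+1%:R^-1.
  have [_ [m Mm <-] mlt] := inf_adherent (en n) D0.
  by exists m.
have u_near (e : R) : 0 < e ->
    exists N, forall n, (N <= n)%N -> rnorm (x - u n) < d + e.
  move=> e0; have [N Ne] : exists N : nat, N.+1%:R^-1 < e.
    exists (Num.bound e^-1); rewrite invf_plt ?posrE//.
    have /archi_boundP/lt_le_trans : 0 <= e^-1 by rewrite invr_ge0 ltW.
    by apply; rewrite ler_nat.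
  exists N => n Nn; have [_ /lt_le_trans] := uP n; apply.
  by rewrite lerD2l (le_trans _ (ltW Ne))// lef_pV2 ?posrE// ler_nat.
have u_cauchy (e : R) : 0 < e -> exists N, forall m n,
    (N <= m)%N -> (N <= n)%N -> rnorm (u m - u n) < e.
  move=> e0.
  (* Two points at distance less than d + h from x are at squared distance
     less than 4 (d + h)^2 - 4 d^2 <= h (8 d + 4) from each other, as h <= 1. *)
  pose h := Num.min 1 (e ^+ 2 / (8 * d + 5)).
  have h0 : 0 < h by rewrite lt_min ltr01 divr_gt0//; [rewrite exprn_gt0|lra].
  have h1 : h <= 1 by rewrite ge_min lexx.
  have he : h * (8 * d + 5) <= e ^+ 2.
    by rewrite -ler_pdivlMr; [rewrite ge_min lexx orbT|lra].
  have [N uN] := u_near _ h0; exists N => m n Nm Nn.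
  have [xm xn] := (uN _ Nm, uN _ Nn).
  have [[Mm _] [Mn _]] := (uP m, uP n).
  have := parallelogram (x - u m) (x - u n).
  have -> : x - u m - (x - u n) = u n - u m by rewrite opprB addrC subrKA.
  have -> : x - u m + (x - u n) = 2%:R%:C%C *: (x - 2^-1 *: (u m + u n)).
    rewrite scalerBr rmorphMn/= rmorph1 scalerA mulfV ?pnatr_eq0// scale1r.
    by rewrite scaler_nat mulr2n opprD addrACA.
  rewrite rnormZr ger0_norm// (rnormC (u n)).
  have : d <= rnorm (x - 2^-1 *: (u m + u n)).
    by apply: dM; rewrite scalerDr; apply: M_linear => //; apply: MZ.
  move: (rnorm_ge0 (x - u m)) (rnorm_ge0 (x - u n)) xm xn.
  move: (rnorm_ge0 (u m - u n)).
  set a := rnorm (x - u m); set b := rnorm (x - u n); set c := rnorm (u m - u n).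
  set t := rnorm _ => c0 a0 b0 am bn dt E.
  rewrite -(@ltr_pXn2r _ 2)// ?nnegrE//; last exact: ltW.
  have a2 : a ^+ 2 < (d + h) ^+ 2 by rewrite ltr_pXn2r// nnegrE// addr_ge0// ltW.
  have b2 : b ^+ 2 < (d + h) ^+ 2 by rewrite ltr_pXn2r// nnegrE// addr_ge0// ltW.
  have t2 : d ^+ 2 <= t ^+ 2 by rewrite ler_pXn2r// nnegrE// (le_trans d0).
  have hh : h * h <= h by rewrite ler_piMl// ltW.
  nra.
have [y uy] := rnorm_complete u_cauchy.
exists y => [|m Mm].
  apply/(closed_rnormP M).1 => // e e0; have [N /(_ N (leqnn N))] := uy _ e0.
  by exists (u N) => //; case: (uP N).
rewrite (le_trans _ (dM _ Mm))//; apply/ler_addgt0Pr => e e0.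
have e2 : 0 < e / 2 by rewrite divr_gt0.
have [[N uN] [K uK]] := (uy _ e2, u_near _ e2).
have := rnorm_triangle (u (N + K)%N) x y.
have := uN (N + K)%N (leq_addr _ _); have := uK (N + K)%N (leq_addl _ _).
rewrite (rnormC y); lra.
Qed.

Lemma orthogonal_decomposition x :
  exists2 y, M y & forall m, M m -> '[x - y, m] = 0.
Proof.
have [y My ymin] := nearest_point x; exists y => // m Mm.
have [->|m0] := eqVneq m 0; first by rewrite linear0r.
have nm : `|m| ^+ 2 != 0 by rewrite expf_neq0// normr_eq0.
have := ymin _ (M_linear ('[x - y, m] / `|m| ^+ 2) Mm My).
rewrite -lecR -!rnormE [_ *: m + y]addrC opprD addrA.
rewrite -(@ler_pXn2r _ 2)// ?nnegrE// sqr_norm_residual// lerDl oppr_ge0.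
rewrite pmulr_lle0 ?invr_gt0 ?exprn_gt0 ?normr_gt0// => le0.
have : `|'[x - y, m]| ^+ 2 == 0 by rewrite eq_le le0 exprn_ge0.
by rewrite expf_eq0/= normr_eq0 => /eqP.
Qed.

Let projection_unique x y z : M y -> M z -> (forall m, M m -> '[x - y, m] = 0) ->
  (forall m, M m -> '[x - z, m] = 0) -> y = z.
Proof.
move=> My Mz yP zP; apply/eqP; rewrite -subr_eq0; apply/eqP/innerxx_eq0.
have Myz : M (y - z) by rewrite addrC -scaleN1r; apply: M_linear.
rewrite {1}(_ : y - z = (x - z) - (x - y)).
  by rewrite linearBl/= yP// zP// subrr.
by rewrite opprB [RHS]addrC subrKA.
Qed.

Lemma orthogonal_projection : exists P : bounded_op H,
  (forall x, M (P x)) /\ (forall x m, M m -> '[x - P x, m] = 0).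
Proof.
have /choice[p pP] x : exists y, M y /\ forall m, M m -> '[x - y, m] = 0.
  by have [y] := orthogonal_decomposition x; exists y.
have p_linear : linear p.
  move=> k x y; have [[[Mx xP] [My yP]] [Mxy xyP]] := (pP x, pP y, pP (k *: x + y)).
  apply: (@projection_unique (k *: x + y)) => //; first exact: M_linear.
  move=> m Mm.
  rewrite opprD addrACA -scalerBr linearDl/= linearZl_LR/=.
  by rewrite xP// yP// mulr0 addr0.
have p_bounded : exists C : R[i], forall x, `|p x| <= C * `|x|.
  exists 1 => x; rewrite mul1r -(@ler_pXn2r _ 2)// ?nnegrE// !sqr_normE.
  have [Mx xP] := pP x.
  rewrite -[in leRHS](subrK (p x) x) hnormDd; last exact: xP.
  by rewrite lerDr dnorm_ge0.
by exists (BoundedOp p_linear p_bounded); split=> x; case: (pP x).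
Qed.

End Projection.

(** * Adjoint operators *)

Section Adjoint.
Variables (R : realType) (H : hilbertType R).
Implicit Types (x y z : H) (k : R[i]) (A B : bounded_op H).
Local Notation "''[' x , y ]" := (inner x y) : ring_scope.

Lemma riesz (f : H -> R[i]) :
  (forall k x y, f (k *: x + y) = k * f x + f y) ->
  (exists C, forall x, `|f x| <= C * `|x|) ->
  exists z, forall x, f x = '[x, z].
Proof.
move=> f_linear f_bounded.
have fB x y : f (x - y) = f x - f y.
  by rewrite addrC -scaleN1r f_linear mulN1r addrC.
have f0 : f 0 = 0 by rewrite -[0 in LHS](subrr 0) fB subrr.
have fZ k x : f (k *: x) = k * f x.
  by rewrite -[_ *: _]addr0 f_linear f0 addr0.
have [f_eq0|/existsNP[v fv]] := pselect (forall x, f x = 0).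
  by exists 0 => x; rewrite linear0r f_eq0.
pose M := [set x | f x = 0].
have M_linear k x y : M x -> M y -> M (k *: x + y).
  by move=> Mx My; rewrite /M/= f_linear Mx My mulr0 addr0.
have M_closed : closed M by apply: (@closed_kernel R H R[i]^o f).
(* u spans the orthogonal complement of the kernel, and f is determined by its
   value there. *)
have [y My vy] := orthogonal_decomposition M_linear f0 M_closed v.
pose u := v - y; have fu : f u != 0 by rewrite fB (My : f y = 0) subr0; apply/eqP.
have u0 : '[u, u] != 0.
  by apply: contra_neq fu => /innerxx_eq0 ->.
exists ((f u / '[u, u])^* *: u) => x.
have : '[u, f x *: u - f u *: x] = 0.
  by apply: vy; rewrite /M/= fB !fZ mulrC subrr.
rewrite linearBr/= !linearZr_LR/= => /eqP; rewrite subr_eq0 => /eqP.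
move=> /(congr1 (@Num.conj R[i])); rewrite !rmorphM/= !conjCK -!innerC => fxu.
by rewrite mulrAC -fxu mulfK.
Qed.

Lemma adjoint_exists A :
  exists B, (forall x y, '[A x, y] = '[x, B y]) /\ `|B| <= `|A|.
Proof.
have /choice[b bP] y : exists z, forall x, '[A x, y] = '[x, z].
  apply: riesz => [k x z|]; first by rewrite linearP linearDl/= linearZl_LR.
  exists (`|A| * `|y|) => x; rewrite (le_trans (CauchySchwarz_inner _ _))//.
  by rewrite mulrAC ler_wpM2r// bop_norm_le.
have b_linear : linear b.
  move=> k x y; apply: inner_inj => z.
  by rewrite -bP !linearDr/= !linearZr_LR/= !bP.
have b_le y : `|b y| <= `|A| * `|y|.
  have [->|by0] := eqVneq (b y) 0; first by rewrite normr0 mulr_ge0.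
  rewrite -(@ler_pM2r _ `|b y|) ?normr_gt0// -expr2 sqr_normE.
  rewrite -[leLHS]ger0_norm ?dnorm_ge0// -bP.
  rewrite (le_trans (CauchySchwarz_inner _ _))// mulrAC.
  by rewrite ler_wpM2r// bop_norm_le.
exists (BoundedOp b_linear (ex_intro _ _ b_le)); split=> [x y|].
  by rewrite bP.
exact: opnorm_ub.
Qed.

Definition adjoint A : bounded_op H := projT1 (cid (adjoint_exists A)).

Lemma innerA A x y : '[A x, y] = '[x, adjoint A y].
Proof. by rewrite /adjoint; case: cid => B []. Qed.

Lemma inner_adjoint A x y : '[adjoint A x, y] = '[x, A y].
Proof. by rewrite innerC -innerA -innerC. Qed.

Lemma adjoint_unique A B : (forall x y, '[A x, y] = '[x, B y]) -> adjoint A = B.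
Proof.
by move=> AB; apply: bop_ext => y; apply: inner_inj => x; rewrite -innerA AB.
Qed.

Lemma adjointK : involutive adjoint.
Proof. by move=> A; apply: adjoint_unique => x y; rewrite inner_adjoint. Qed.

Lemma adjointM A B : adjoint (A * B) = adjoint B * adjoint A.
Proof. by apply: adjoint_unique => x y; rewrite !bopM !innerA. Qed.

Lemma adjointB A B : adjoint (A - B) = adjoint A - adjoint B.
Proof.
by apply: adjoint_unique => x y; rewrite !bopB linearBl linearBr/= !innerA.
Qed.

Lemma adjoint0 : adjoint 0 = 0.
Proof. by apply: adjoint_unique => x y; rewrite linear0l linear0r. Qed.

Lemma adjoint1 : adjoint 1 = 1.
Proof. exact: adjoint_unique. Qed.

Lemma adjointX A n : adjoint (A ^+ n) = adjoint A ^+ n.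
Proof.
elim: n => [|n IH]; first by rewrite !expr0 adjoint1.
by rewrite exprS exprSr adjointM IH.
Qed.

Lemma norm_adjoint_le A : `|adjoint A| <= `|A|.
Proof. by rewrite /adjoint; case: cid => B []. Qed.

End Adjoint.

(** * Uniform boundedness *)

Section UniformBoundedness.
Variables (R : realType) (H : hilbertType R).
Implicit Types (x y z : H).
Local Notation "''[' x , y ]" := (inner x y) : ring_scope.

(** A gliding-hump argument. If S is unbounded, build points u_n, each within
    4^(-n) / 2 of the previous one, and y_n in S so large that <u_(n+1), y_n>
    has modulus at least 4^(-n) / 4 times the norm of y_n. The limit l of the
    u_n is within (2/3) 4^(-n-1) = 4^(-n) / 6 of u_(n+1), so <l, y_n> still has
    modulus at least 4^(-n) / 12 times the norm of y_n. The y_n are chosen to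
    make this larger than n, so S is not weakly bounded at l. *)
Lemma weakly_bounded_bounded (S : set H) :
  (forall x, exists M : R, forall y, S y -> `|'[x, y]| <= M%:C%C) ->
  exists M : R, forall y, S y -> rnorm y <= M.
Proof.
move=> S_weak; apply: contrapT => /forallNP S_unbounded.
pose q : R := 4^-1.
have q0 n : 0 < q ^+ n by rewrite exprn_gt0// invr_gt0.
have step (nx : nat * H) : exists x'y : H * H,
    [/\ S x'y.2, 12 * nx.1%:R < q ^+ nx.1 * rnorm x'y.2,
        rnorm (x'y.1 - nx.2) <= q ^+ nx.1 / 2 &
        (q ^+ nx.1 / 4 * rnorm x'y.2)%:C%C <= `|'[x'y.1, x'y.2]|].
  case: nx => n x /=.
  have [y Sy ny] : exists2 y, S y & 12 * n%:R < q ^+ n * rnorm y.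
    apply: contrapT => noy; apply: (S_unbounded (12 * n%:R / q ^+ n)) => y Sy.
    rewrite ler_pdivlMr// leNgt (mulrC (rnorm y)).
    by apply/negP => yn; apply: noy; exists y.
  have y0 : 0 < rnorm y.
    by rewrite -(pmulr_rgt0 _ (q0 n)) (le_lt_trans _ ny)// mulr_ge0.
  (* The values of <., y> at x and at x + v differ by <v, y>, so that one of them
     is at least half as large as <v, y>. *)
  have [xbig|xsmall] := leP (q ^+ n / 4 * rnorm y)
      (complex.Re `|'[x, y]|).
    exists (x, y); split=> //=.
      by rewrite subrr rnorm0 divr_ge0// ltW.
    by rewrite -[leRHS]RRe_real ?normr_real// lecR.
  pose v := (q ^+ n / 2 / rnorm y)%:C%C *: y.
  have nv : rnorm v = q ^+ n / 2.
    rewrite rnormZr ger0_norm; last by rewrite !divr_ge0 ?rnorm_ge0 ?ltW.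
    by rewrite divfK// gt_eqF.
  exists (x + v, y); split=> //=; first by rewrite addrC addKr nv.
  have vy : '[v, y] = (q ^+ n / 2 * rnorm y)%:C%C.
    rewrite linearZl_LR/= -sqr_normE rnormE -rmorphXn -rmorphM/=.
    by congr (_%:C)%C; field; rewrite gt_eqF.
  rewrite linearDl/= vy -[leRHS](addrK (`|'[x, y]|)) lerBrDr.
  rewrite -[`|'[x, y]| in leRHS]normrN (le_trans _ (ler_normD _ _))//.
  rewrite addrAC subrr add0r [leRHS]ger0_norm; last first.
    by rewrite ler0c mulr_ge0 ?divr_ge0// ltW.
  rewrite -[`|_|]RRe_real ?normr_real// -rmorphD lecR; nra.
have [f fP] := choice step.
pose u := fix u n := if n is m.+1 then (f (m, u m)).1 else 0.
have u_dist n k : rnorm (u (n + k)%N - u n) <= 2 / 3 * (q ^+ n - q ^+ (n + k)).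
  elim: k => [|k IH]; first by rewrite addn0 !subrr rnorm0 mulr0.
  rewrite addnS (le_trans (rnorm_triangle (u (n + k)%N) _ _))//.
  have [_ _ uS _] := fP ((n + k)%N, u (n + k)%N).
  by rewrite (le_trans (lerD uS IH))//= exprS /q; lra.
have u_dist_le n k : rnorm (u (n + k)%N - u n) <= 2 / 3 * q ^+ n.
  rewrite (le_trans (u_dist n k))// ler_wpM2l// ?divr_ge0//.
  by rewrite gerDl oppr_le0 ltW.
have [l ul] : exists l, forall e : R, 0 < e ->
    exists N, forall n, (N <= n)%N -> rnorm (l - u n) < e.
  apply: rnorm_complete => e e0.
  pose N := Num.bound (2 / e); exists N => m n Nm Nn.
  have qN : 2 * q ^+ N < e.
    have : 2 / e < N%:R by rewrite archi_boundP// divr_ge0// ltW.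
    rewrite ltr_pdivrMr// /q exprVn ltr_pdivrMr ?exprn_gt0// mulrC => /lt_trans.
    by apply; rewrite ltr_pM2l// -natrX ltr_nat ltn_expl.
  have := rnorm_triangle (u N) (u m) (u n).
  have := u_dist_le N (m - N)%N; have := u_dist_le N (n - N)%N.
  rewrite !subnKC// (rnormC (u N)); have := q0 N; lra.
have l_dist n : rnorm (u n - l) <= 2 / 3 * q ^+ n.
  apply/ler_addgt0Pr => e e0; have [N /(_ (n + N)%N (leq_addl _ _)) lN] := ul _ e0.
  rewrite rnormC (le_trans (rnorm_triangle (u (n + N)%N) _ _))// addrC.
  by rewrite lerD// ltW.
have [M lM] := S_weak l.
have [n Mn] : exists n : nat, M < n%:R.
  by exists (Num.bound `|M|); rewrite (le_lt_trans (ler_norm _))// archi_boundP.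
have [Sy ny _ wy] := fP (n, u n); have un : (f (n, u n)).1 = u n.+1 by [].
rewrite /= in Sy ny wy; rewrite un in wy; move: (f (n, u n)).2 Sy ny wy => y.
move: (u n.+1) (l_dist n.+1) => w wl Sy ny wy.
have : `|'[w, y]| <= (M + 2 / 3 * q ^+ n.+1 * rnorm y)%:C%C.
  rewrite -[w](subrK l) linearDl/= addrC (le_trans (ler_normD _ _))//.
  rewrite rmorphD/= lerD ?lM// (le_trans (CauchySchwarz_inner _ _))//.
  by rewrite !rnormE -rmorphM/= lecR ler_wpM2r ?rnorm_ge0.
move=> /(le_trans wy); rewrite lecR exprS {2}/q.
move: ny; set a := q ^+ n; set b := rnorm y => ny wy'.
have : a * b / 12 <= M by lra.
lra.
Qed.

End UniformBoundedness.

(** * Factorization and closed ranges *)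

Section ClosedRange.
Variables (R : realType) (Y : normedModType R[i]).
Implicit Types (S E : bounded_op Y).

Lemma closed_null_space S : closed [set x | S x = 0].
Proof.
by apply: closed_kernel (bop_bounded S) => x y; rewrite linearB.
Qed.

(** If S E S = S, the range of S is the null space of 1 - S E. *)
Lemma regular_closed_range S : regular S -> closed (range S).
Proof.
move=> [E SES]; have -> : range S = [set x | (1 - S * E) x = 0].
  apply/seteqP; split=> [_ [x _ <-]|x]; rewrite /mkset bopB bopM.
    by rewrite -[in X in X - _]SES subrr.
  by move/eqP; rewrite subr_eq0 => /eqP xE; exists (E x).
exact: closed_null_space.
Qed.

End ClosedRange.

Section Factorization.
Variables (R : realType) (H : hilbertType R).
Implicit Types (x y z : H) (k : R[i]) (A B C E V : bounded_op H).
Local Notation "''[' x , y ]" := (inner x y) : ring_scope.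

Lemma range_linear B k x y :
  range B x -> range B y -> range B (k *: x + y).
Proof.
by move=> [a _ <-] [b _ <-]; exists (k *: a + b); rewrite ?linearP.
Qed.

(** A vector orthogonal to the range of the adjoint of B is killed by B, so
    the orthogonal complement of the null space cannot be larger than the
    closure of that range. *)
Lemma orthogonal_null_space B x :
  (forall r, B r = 0 -> '[x, r] = 0) -> closure (range (adjoint B)) x.
Proof.
move=> xN; have range0 : closure (range (adjoint B)) 0.
  by apply: subset_closure; exists 0; rewrite ?linear0.
have [p Mp pP] := orthogonal_decomposition
  (closure_linear (@range_linear (adjoint B))) range0 (@closed_closure _ _) x.
suff /eqP : x - p = 0 by rewrite subr_eq0 => /eqP ->.
apply: innerxx_eq0; rewrite linearBr/= (pP _ Mp) subr0 innerC xN ?conjC0//.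
apply: inner_inj => y; rewrite linear0r -inner_adjoint innerC pP ?conjC0//.
by apply: subset_closure; exists y.
Qed.

(** If V x = B z, then <x, V* y> = <z, B* y>; the vectors V* y for which B* y
    is in the unit ball are therefore weakly bounded, hence bounded. *)
Lemma adjoint_dominated B V : range V `<=` range B ->
  exists2 M : R, 0 <= M & forall y, rnorm (adjoint V y) <= M * rnorm (adjoint B y).
Proof.
move=> VB.
have eqVB x : exists z, forall y, '[x, adjoint V y] = '[z, adjoint B y].
  have [z _ Bz] : range B (V x) by apply: VB; exists x.
  by exists z => y; rewrite -!innerA Bz.
pose S := [set adjoint V y | y in [set y | rnorm (adjoint B y) <= 1]].
have [M SM] : exists M : R, forall w, S w -> rnorm w <= M.
  apply: weakly_bounded_bounded => x; have [z xz] := eqVB x.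
  exists (rnorm z) => _ [y /= y1 <-]; rewrite xz.
  rewrite (le_trans (CauchySchwarz_inner _ _))// !rnormE -rmorphM/= lecR.
  by rewrite ler_piMr ?rnorm_ge0.
have M0 : 0 <= M.
  rewrite (le_trans (rnorm_ge0 (0 : H)))// SM//; exists 0; rewrite ?linear0//=.
  by rewrite linear0 rnorm0.
exists M => // y; have [By0|By] := eqVneq (adjoint B y) 0.
  rewrite (_ : adjoint V y = 0) ?rnorm0 ?mulr_ge0 ?rnorm_ge0//.
  by apply: inner_inj => x; have [z ->] := eqVB x; rewrite By0 !linear0r.
have nBy : 0 < rnorm (adjoint B y) by rewrite -ltcR -rnormE normr_gt0.
pose t := (rnorm (adjoint B y))^-1.
have t0 : 0 < t by rewrite invr_gt0.
rewrite -ler_pdivrMr// mulrC -[_^-1](gtr0_norm t0) -rnormZr -linearZ SM//.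
exists (t%:C%C *: y) => //=; rewrite linearZ/= rnormZr gtr0_norm// mulVf//.
by rewrite gt_eqF.
Qed.

(** C x is the solution z of B z = V x that is orthogonal to the null space of
    B. Against a vector B* y, <C x, B* y> = <x, V* y> is bounded by M times the
    norms of x and B* y; as C x is a limit of vectors B* y, its norm is at most
    M times that of x. *)
Lemma douglas B V : range V `<=` range B -> exists C, V = B * C.
Proof.
move=> VB; have [M M0 domVB] := adjoint_dominated VB.
pose N := [set r | B r = 0].
have N_linear k x y : N x -> N y -> N (k *: x + y).
  by rewrite /N /mkset => Bx By; rewrite linearP/= Bx By scaler0 addr0.
have N0 : N 0 by rewrite /N/= linear0.
have /choice[c cP] x : exists z, B z = V x /\ forall r, N r -> '[z, r] = 0.
  have [z _ Bz] : range B (V x) by apply: VB; exists x.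
  have [p Np zp] :=
    orthogonal_decomposition N_linear N0 (@closed_null_space _ _ B) z.
  by exists (z - p); rewrite linearB/= (Np : B p = 0) subr0.
have c_linear : linear c.
  move=> k x y; apply/eqP; rewrite -subr_eq0; apply/eqP/innerxx_eq0.
  have [[[Bx xN] [By yN]] [Bxy xyN]] := (cP x, cP y, cP (k *: x + y)).
  have Nd : N (c (k *: x + y) - (k *: c x + c y)).
    by rewrite /N /mkset linearB/= linearP/= Bx By Bxy linearP subrr.
  rewrite linearBl/= linearDl/= linearZl_LR/= xN// yN// xyN//.
  by rewrite mulr0 addr0 subr0.
have c_bounded : exists K : R[i], forall x, `|c x| <= K * `|x|.
  exists M%:C%C => x; rewrite !rnormE -rmorphM/= lecR.
  have [Bx xN] := cP x.
  have [cx0|cx0] := eqVneq (c x) 0.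
    by rewrite cx0 rnorm0 mulr_ge0 ?rnorm_ge0.
  have ncx : 0 < rnorm (c x) by rewrite -ltcR -rnormE normr_gt0.
  rewrite -(@ler_pM2r _ (rnorm (c x)))//; apply/ler_addgt0Pr => e e0.
  set n := rnorm (c x) in ncx *; set m := M * rnorm x.
  have m0 : 0 <= m by rewrite mulr_ge0 ?rnorm_ge0.
  have nm : 0 < n + m by rewrite ltr_wpDr.
  have /closure_rnormP/(_ _ (divr_gt0 e0 nm))[_ [y _ <-] xy] :=
    orthogonal_null_space xN.
  set w := adjoint B y in xy.
  have nw : rnorm w <= n + rnorm (c x - w).
    by have := rnorm_triangle (c x) w 0; rewrite !subr0 (rnormC w) addrC.
  have : n * n <= n * rnorm (c x - w) + m * rnorm w.
    rewrite -lecR rmorphD !rmorphM/= -!rnormE -expr2 sqr_normE.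
    rewrite -[leLHS]ger0_norm ?dnorm_ge0// -[X in '[_, X]](subrK w).
    rewrite linearDr/= (le_trans (ler_normD _ _))// lerD ?CauchySchwarz_inner//.
    rewrite -innerA Bx innerA (le_trans (CauchySchwarz_inner _ _))//.
    rewrite !rnormE (mulrC M%:C%C) -mulrA ler_wpM2l ?ler0c ?rnorm_ge0//.
    by rewrite -rmorphM lecR.
  move: xy; rewrite ltr_pdivlMr//; move: (rnorm_ge0 (c x - w)).
  set d := rnorm (c x - w) in nw *; nra.
exists (BoundedOp c_linear c_bounded); apply: bop_ext => x.
by rewrite bopM /=; case: (cP x).
Qed.

(** The orthogonal projection P onto a closed range of B factors as P = B E by
    Douglas' lemma, and P B = B. *)
Lemma closed_range_regular B :
  closed (range B) <-> regular B.
Proof.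
split=> [cB|]; last exact: regular_closed_range.
have B0 : range B 0 by exists 0; rewrite ?linear0.
have [P [PB Porth]] := orthogonal_projection (@range_linear B) B0 cB.
have [E PE] : exists E, P = B * E by apply: douglas => _ [x _ <-].
exists E; rewrite -PE; apply: bop_ext => x; rewrite bopM.
apply/esym/eqP; rewrite -subr_eq0; apply/eqP/innerxx_eq0; apply: Porth.
by rewrite addrC -scaleN1r; apply: range_linear => //; exists x.
Qed.

Fact rank_one_linear x y : linear (fun z => '[z, y] *: x).
Proof. by move=> k u v; rewrite linearDl/= linearZl_LR scalerDl scalerA. Qed.
Fact rank_one_bounded x y :
  exists M : R[i], forall z, `|'[z, y] *: x| <= M * `|z|.
Proof.
exists (`|x| * `|y|) => z; rewrite normrZ mulrC -mulrA ler_wpM2l//.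
by rewrite mulrC CauchySchwarz_inner.
Qed.
Definition rank_one x y := BoundedOp (rank_one_linear x y) (rank_one_bounded x y).

Lemma mul_rank_one B x y : B * rank_one x y = rank_one (B x) y.
Proof. by apply: bop_ext => z; rewrite bopM /= linearZ. Qed.

Lemma rank_oneB x x' y : rank_one x y - rank_one x' y = rank_one (x - x') y.
Proof. by apply: bop_ext => z; rewrite bopB /= scalerBr. Qed.

Lemma rnorm_rank_one_le x y : rnorm (rank_one x y) <= rnorm x * rnorm y.
Proof.
rewrite -lecR rmorphM/= -!rnormE; apply: opnorm_ub; first by rewrite mulr_ge0.
move=> z /=; rewrite normrZ mulrC -mulrA ler_wpM2l//.
by rewrite mulrC CauchySchwarz_inner.
Qed.

End Factorization.

(** * Ascent and descent as least exponents *)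

Lemma inf_nat_someP (A : set nat) n :
  inf_nat A = Some n <-> A n /\ forall m, A m -> (n <= m)%N.
Proof.
rewrite /inf_nat; case: pselect => [exA|noA].
  case: ex_minnP => m /asboolP Am m_min; split=> [[<-]|[An n_min]].
    by split=> // k Ak; apply: m_min; apply/asboolP.
  by congr Some; apply/eqP; rewrite eqn_leq n_min// m_min//; apply/asboolP.
by split=> // -[An _]; case: noA; exists n; apply/asboolP.
Qed.

Lemma inf_nat_exists (A : set nat) n : A n ->
  exists2 m, inf_nat A = Some m & A m /\ (m <= n)%N.
Proof.
move=> An; have exA : exists n, `[< A n >] by exists n; apply/asboolP.
have [m /asboolP Am m_min] := ex_minnP exA.
have m_le k : A k -> (m <= k)%N by move=> Ak; apply: m_min; apply/asboolP.
by exists m; [apply/inf_nat_someP|split=> //; apply: m_le].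
Qed.

(** * Multiplication operators *)

Section MultiplicationOperators.
Variables (R : realType) (Y : completeNormedModType R[i]).
Implicit Types (T U : bounded_op Y) (l : R[i]).

Lemma left_mulX T n : left_mul T ^+ n = left_mul (T ^+ n).
Proof.
elim: n => [|n IH]; apply: bop_ext => U; first by rewrite !expr0 /= mul1r.
by rewrite !exprS IH bopM /= mulrA.
Qed.

Lemma right_mulX T n : right_mul T ^+ n = right_mul (T ^+ n).
Proof.
elim: n => [|n IH]; apply: bop_ext => U; first by rewrite !expr0 /= mulr1.
by rewrite exprS exprSr IH bopM /= mulrA.
Qed.

Lemma left_mulB T l :
  left_mul T - l *: (1 : bounded_op (bounded_op Y)) =
  left_mul (T - l *: (1 : bounded_op Y)).
Proof. by apply: bop_ext => U; apply: bop_ext => x. Qed.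

Lemma right_mulB T l :
  right_mul T - l *: (1 : bounded_op (bounded_op Y)) =
  right_mul (T - l *: (1 : bounded_op Y)).
Proof.
by apply: bop_ext => U; apply: bop_ext => x; rewrite /= linearB/= [in RHS]linearZ.
Qed.

End MultiplicationOperators.

(** * Left multiplication operators *)

Section HilbertSpace.
Variables (R : realType) (H : hilbertType R).
Implicit Types (A B C E T U V : bounded_op H) (x y z : H).
Local Notation "''[' x , y ]" := (inner x y) : ring_scope.

Lemma range_left_mul B : range (left_mul B) = [set V | range V `<=` range B].
Proof.
apply/seteqP; split=> [_ [U _ <-] _ [x _ <-]|V /douglas[C ->]].
  by exists (U x).
by exists C.
Qed.

Lemma range_left_mul_inj A B :
  range (left_mul A) = range (left_mul B) <-> range A = range B.
Proof.
rewrite !range_left_mul; split=> [AB|->//]; apply/seteqP; split.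
  by have : [set V : bounded_op H | range V `<=` range A] A by []; rewrite AB.
by have : [set V : bounded_op H | range V `<=` range B] B by []; rewrite -AB.
Qed.

(** The null space of L_A is the set of the operators with range in the null
    space of A; rank-one operators recover the latter from it. *)
Lemma null_space_left_mul_subset A B :
  null_space (left_mul A) `<=` null_space (left_mul B) <->
  null_space A `<=` null_space B.
Proof.
split=> [AB x Ax|AB U AU].
  have /AB : null_space (left_mul A) (rank_one x x).
    rewrite /null_space /mkset /= mul_rank_one (Ax : A x = 0).
    by apply: bop_ext => z; rewrite /= scaler0.
  rewrite /null_space /mkset /= => /(congr1 (fun U : bounded_op H => U x)) /=.
  rewrite linearZ/= => /eqP; rewrite scaler_eq0 => /orP[/eqP/innerxx_eq0 ->|/eqP//].
  by rewrite linear0.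
apply: bop_ext => x; apply: AB.
exact: (congr1 (fun V : bounded_op H => V x) (AU : A * U = 0)).
Qed.

Lemma null_space_left_mul_inj A B :
  null_space (left_mul A) = null_space (left_mul B) <->
  null_space A = null_space B.
Proof.
split=> /seteqP[AB BA]; apply/seteqP;
  by split; apply/null_space_left_mul_subset.
Qed.

Lemma descent_left_mul A : descent (left_mul A) = descent A.
Proof.
congr inf_nat; apply/seteqP.
by split=> n; rewrite /mkset !left_mulX range_left_mul_inj.
Qed.

Lemma ascent_left_mul A : ascent (left_mul A) = ascent A.
Proof.
congr inf_nat; apply/seteqP.
by split=> n; rewrite /mkset !left_mulX null_space_left_mul_inj.
Qed.

(** If x is a limit of vectors B a, then the rank-one operator of x is the
    limit of B times the rank-one operators of the vectors a, hence has the
    form B U, and x is in the range of B. Conversely a generalized inverse E of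
    B gives the generalized inverse L_E of L_B. *)
Lemma closed_range_left_mul B :
  closed (range (left_mul B)) <-> closed (range B).
Proof.
split=> [cB|/closed_range_regular[E BEB]]; last first.
  apply: regular_closed_range; exists (left_mul E).
  by apply: bop_ext => U; rewrite !bopM /= mulrA mulrA BEB.
apply/closed_rnormP => x xB.
have [->|x0] := eqVneq x 0; first by exists 0; rewrite ?linear0.
have nx : 0 < rnorm x by rewrite -ltcR -rnormE normr_gt0.
have : range (left_mul B) (rank_one x x).
  apply/(closed_rnormP _).1 => // e e0.
  have [_ [a _ <-] xa] := xB _ (divr_gt0 e0 nx).
  exists (B * rank_one a x); first by exists (rank_one a x).
  rewrite mul_rank_one rank_oneB (le_lt_trans (rnorm_rank_one_le _ _))//.
  by rewrite -ltr_pdivlMr.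
move=> [U _ /(congr1 (fun V : bounded_op H => V x)) /= BUx].
exists ('[x, x]^-1 *: U x) => //; rewrite linearZ/= BUx scalerA mulVf ?scale1r//.
by apply: contra_neq x0 => /innerxx_eq0.
Qed.

Lemma right_drazin_left_mul A :
  right_drazin_invertible (left_mul A) <-> right_drazin_invertible A.
Proof.
rewrite /right_drazin_invertible descent_left_mul.
by split=> -[n dn cn]; exists n => //; move: cn;
  rewrite left_mulX closed_range_left_mul.
Qed.

Lemma left_drazin_left_mul A :
  left_drazin_invertible (left_mul A) <-> left_drazin_invertible A.
Proof.
rewrite /left_drazin_invertible ascent_left_mul.
by split=> -[n an cn]; exists n => //; move: cn;
  rewrite left_mulX closed_range_left_mul.
Qed.

(** * Drazin invertibility through stability and regularity *)

Lemma left_stable_adjoint A n : left_stable (adjoint A) n <-> right_stable A n.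
Proof.
split=> -[C AC]; exists (adjoint C).
  by rewrite -[LHS]adjointK adjointX AC adjointM -adjointX adjointK.
by rewrite -adjointX AC adjointM adjointX.
Qed.

Lemma regular_adjoint A : regular (adjoint A) <-> regular A.
Proof.
split=> -[E AEA]; exists (adjoint E).
  by rewrite -[RHS]adjointK -AEA !adjointM !adjointK mulrA.
by rewrite -!adjointM mulrA AEA.
Qed.

Lemma range_stable A n :
  range (A ^+ n) = range (A ^+ n.+1) <-> right_stable A n.
Proof.
split=> [AA|[C AC]]; first by apply: douglas; rewrite AA.
apply/seteqP; split; first by rewrite {1}AC => _ [x _ <-]; exists (C x).
by rewrite exprSr => _ [x _ <-]; exists (A x).
Qed.

Lemma left_stable_null_space A n :
  left_stable A n -> null_space (A ^+ n) = null_space (A ^+ n.+1).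
Proof.
move=> [C AC]; apply/seteqP; split=> x; rewrite /null_space /mkset.
  by rewrite exprS bopM => ->; rewrite linear0.
by rewrite AC bopM => ->; rewrite linear0.
Qed.

(** This is the counterpart for null spaces of Douglas' lemma: without
    regularity of B, the operator taking B x to V x need not be bounded. *)
Lemma null_space_factor B V : regular B -> null_space B `<=` null_space V ->
  exists C, V = C * B.
Proof.
move=> [E BEB] BV; exists (V * E); apply: bop_ext => x.
apply/eqP; rewrite -subr_eq0 -mulrA !bopM -linearB; apply/eqP; apply: BV.
by rewrite /null_space /mkset linearB/= -!bopM mulrA BEB subrr.
Qed.

Lemma null_space_stable A m n :
  null_space (A ^+ m) = null_space (A ^+ m.+1) -> (m <= n)%N ->
  null_space (A ^+ m) = null_space (A ^+ n).
Proof.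
move=> Am /subnKC <-; elim: (n - m)%N => [|k IH]; first by rewrite addn0.
apply/seteqP; split=> x; rewrite /null_space /mkset.
  by rewrite addnC exprD bopM => ->; rewrite linear0.
rewrite addnS exprSr bopM => Ax.
have : null_space (A ^+ m) (A x) by rewrite IH.
rewrite /null_space /mkset -bopM -exprSr => Amx.
by have : null_space (A ^+ m.+1) x by []; rewrite -Am.
Qed.

(** The exponent n is arbitrary, whereas the definition refers to the descent
    m: once A is right stable, the ranges of A^m and A^n coincide. *)
Lemma right_drazinP A : right_drazin_invertible A <->
  exists n, right_stable A n /\ regular (A ^+ n).
Proof.
split=> [[n /inf_nat_someP[/range_stable An _] /closed_range_regular ?]|].
  by exists n.
move=> [n [An rn]].
have [m dm [/range_stable Am mn]] := @inf_nat_exists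
  [set k | range (A ^+ k) = range (A ^+ k.+1)] n (iffRL (range_stable _ _) An).
exists m => //; have [D AmD] := right_stable_factor Am mn.
have -> : range (A ^+ m) = range (A ^+ n); last exact/closed_range_regular.
apply/seteqP; split; first by rewrite AmD => _ [x _ <-]; exists (D x).
rewrite -(subnKC mn) exprD => _ [x _ <-].
by exists ((A ^+ (n - m)) x).
Qed.

(** Equality of null spaces is weaker than left stability, but it suffices
    here because A^(n+1) is regular. For the converse, the ascent m may be
    smaller than n; the null spaces of A^m and A^n agree, so A^m factors through
    the regular operator A^n, which makes A left stable at m already. *)
Lemma left_drazinP A : left_drazin_invertible A <->
  exists n, left_stable A n /\ regular (A ^+ n).
Proof.
split=> [[n /inf_nat_someP[An _] /closed_range_regular rn]|[n [An rn]]].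
  have sn : left_stable A n by apply: null_space_factor => //; rewrite An.
  by exists n; split=> //; apply/(left_stable_regular sn (leqnSn n)).
have [m am [Am mn]] := @inf_nat_exists
  [set k | null_space (A ^+ k) = null_space (A ^+ k.+1)] n
  (left_stable_null_space An).
exists m => //; apply/closed_range_regular.
have [C AmC] : exists C, A ^+ m = C * A ^+ n.
  by apply: null_space_factor => //; rewrite (null_space_stable Am mn).
have sm : left_stable A m.
  have [D AnD] := left_stable_factor An (leqnSn n).
  exists (C * D * A ^+ (n - m)).
  by rewrite -!mulrA -exprD addnS subnK// -AnD.
apply/(left_stable_regular sm (leqnSn m)).
exact/(left_stable_regular sm mn).
Qed.

Lemma left_drazin_adjoint A :
  left_drazin_invertible (adjoint A) <-> right_drazin_invertible A.
Proof.
rewrite left_drazinP right_drazinP.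
by split=> -[n An]; exists n; move: An;
  rewrite left_stable_adjoint -adjointX regular_adjoint.
Qed.

Lemma right_drazin_adjoint A :
  right_drazin_invertible (adjoint A) <-> left_drazin_invertible A.
Proof. by rewrite -left_drazin_adjoint adjointK. Qed.

(** * Right multiplication operators *)

(** Since the adjoint of U B is B* U*, the adjoint carries R_B to left
    multiplication by B*. Ranges and null spaces are written as preimages
    because preimages under an involution can be cancelled. *)
Lemma range_right_mul B :
  range (right_mul B) = @adjoint R H @^-1` range (left_mul (adjoint B)).
Proof.
apply/seteqP; split=> [_ [U _ <-]|V [U _ /= UV]].
  by exists (adjoint U) => //=; rewrite adjointM.
by exists (adjoint U) => //=; rewrite -[V]adjointK -UV adjointM adjointK.
Qed.

Lemma null_space_right_mul B :
  null_space (right_mul B) = @adjoint R H @^-1` null_space (left_mul (adjoint B)).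
Proof.
apply/seteqP; split=> V; rewrite /null_space /preimage /mkset /= -adjointM.
  by move=> ->; rewrite adjoint0.
by move=> VB; rewrite -[LHS]adjointK VB adjoint0.
Qed.

Lemma preimage_adjoint_inj (S1 S2 : set (bounded_op H)) :
  @adjoint R H @^-1` S1 = @adjoint R H @^-1` S2 <-> S1 = S2.
Proof.
split=> [SS|->//]; apply/seteqP; split=> U; rewrite -[U]adjointK.
  by rewrite -[X in X -> _]/((@adjoint R H @^-1` S1) (adjoint U)) SS.
by rewrite -[X in X -> _]/((@adjoint R H @^-1` S2) (adjoint U)) -SS.
Qed.

Lemma closed_preimage_adjoint (S : set (bounded_op H)) :
  closed (@adjoint R H @^-1` S) <-> closed S.
Proof.
have impl (S' : set (bounded_op H)) : closed S' -> closed (@adjoint R H @^-1` S').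
  move=> cS; apply/closed_rnormP => U US; apply: ((closed_rnormP _).1 cS) => e e0.
  have [V SV UV] := US _ e0; exists (adjoint V) => //.
  by rewrite -adjointB (le_lt_trans _ UV)// -lecR -!rnormE norm_adjoint_le.
split=> [/impl|/impl//]; congr closed; apply/seteqP.
by split=> U; rewrite /preimage /mkset adjointK.
Qed.

Lemma descent_right_mul A : descent (right_mul A) = descent (left_mul (adjoint A)).
Proof.
congr inf_nat; apply/seteqP; split=> n;
  by rewrite /mkset !right_mulX !left_mulX !range_right_mul !adjointX
    preimage_adjoint_inj.
Qed.

Lemma ascent_right_mul A : ascent (right_mul A) = ascent (left_mul (adjoint A)).
Proof.
congr inf_nat; apply/seteqP; split=> n;
  by rewrite /mkset !right_mulX !left_mulX !null_space_right_mul !adjointX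
    preimage_adjoint_inj.
Qed.

Lemma right_drazin_right_mul A :
  right_drazin_invertible (right_mul A) <-> left_drazin_invertible A.
Proof.
rewrite -right_drazin_adjoint -right_drazin_left_mul.
rewrite /right_drazin_invertible descent_right_mul.
by split=> -[n dn cn]; exists n => //; move: cn;
  rewrite right_mulX left_mulX range_right_mul closed_preimage_adjoint adjointX.
Qed.

Lemma left_drazin_right_mul A :
  left_drazin_invertible (right_mul A) <-> right_drazin_invertible A.
Proof.
rewrite -left_drazin_adjoint -left_drazin_left_mul.
rewrite /left_drazin_invertible ascent_right_mul.
by split=> -[n dn cn]; exists n => //; move: cn;
  rewrite right_mulX left_mulX range_right_mul closed_preimage_adjoint adjointX.
Qed.

Lemma drazin_invertibleP A : drazin_invertible A <->
  left_drazin_invertible A /\ right_drazin_invertible A.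
Proof.
rewrite left_drazinP right_drazinP; split.
  by move=> /drazin_invertible_stable[m [lm rm Am]]; split; exists m.
by move=> [[m [lm _]] [n [rn _]]]; apply: stable_drazin_invertible lm rn.
Qed.

End HilbertSpace.

Theorem theorem9 (R : realType) (H : hilbertType R) (T : bounded_op H) :
  [/\ sigma_desc T = sigma_desc (left_mul T),
      sigma_RD T = sigma_RD (left_mul T),
      sigma_LD T = sigma_LD (left_mul T),
      sigma_LD T = sigma_RD (right_mul T) &
      sigma_RD T = sigma_LD (right_mul T)] /\
  sigma_DR T = sigma_LD (left_mul T) `|` sigma_LD (right_mul T).
Proof.
split; last first.
  rewrite predeqE => l; rewrite /sigma_DR /sigma_LD /setU /mkset.
  by rewrite left_mulB right_mulB left_drazin_left_mul left_drazin_right_mul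
    drazin_invertibleP not_andE.
split; rewrite predeqE => l;
  rewrite /sigma_desc /sigma_RD /sigma_LD /mkset ?left_mulB ?right_mulB.
- by rewrite descent_left_mul.
- by rewrite right_drazin_left_mul.
- by rewrite left_drazin_left_mul.
- by rewrite right_drazin_right_mul.
- by rewrite left_drazin_right_mul.
Qed.
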